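(* Let $n\ge2$ and let $C\subset\mathbb{S}^{n-1}$ be a spherical $4$-design. Then $$\rho(C)\le u(a_0,b_0),$$ where $$u(a,b):=-\frac a2+\frac12\left(a^2-4b+4\sqrt{\frac{|C|}{n}\left(b^2+\frac{a^2+2b}{n}+\frac{3}{n(n+2)}\right)}\,\right)^{1/2},$$ $$b_0:=\frac{3n(n+1)-(n+2)|C|+\sqrt{n(n-1)\left[2(n+2)|C|-3n(n+3)\right]}}{n(n+2)\left(|C|-2n\right)},$$ $$a_0:=\frac{nb_0+1}{n}\sqrt{\frac{|C|(nb_0+1)-n^2b_0}{nb_0+2}}.$$
   Context: A finite set $C\subset\mathbb{S}^{n-1}\subset\mathbb{R}^n$ is a spherical $\tau$-design if for every polynomial $f(x_1,\dots,x_n)$ of degree at most $\tau$ the average of $f$ over $C$ equals the average of $f$ over $\mathbb{S}^{n-1}$ with respect to the (rotation-invariant) Lebesgue measure. $\rho(C):=\min_{y\in\mathbb{S}^{n-1}}\max_{x\in C}\langle x,y\rangle$ (equivalently $\rho(C)=1-r(C)^2/2$, where $r(C)=\max_{y\in\mathbb{S}^{n-1}}\min_{x\in C}d(x,y)$ is the covering radius of $C$ in Euclidean distance). *)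

(* Defs.v *)
From HB Require Import structures.
From mathcomp Require Import all_boot all_order all_algebra.
From mathcomp Require Import finmap.
From mathcomp Require mpoly.
From mathcomp Require Import all_classical all_reals all_analysis.
Import Order.TTheory GRing.Theory Num.Theory.

Set Implicit Arguments.
Unset Strict Implicit.
Unset Printing Implicit Defensive.

Local Open Scope classical_set_scope.
Local Open Scope ring_scope.

Definition dotp (R : realType) (n : nat) (x y : 'rV[R]_n) : R :=
  \sum_(i < n) x 0 i * y 0 i.

Definition enorm (R : realType) (n : nat) (x : 'rV[R]_n) : R :=
  Num.sqrt (dotp x x).

(* S^{n-1} and the closed unit ball in R^n; the norm of the library on 'rV is
   the sup norm, so it is not used here. *)
Definition sphere (R : realType) (n : nat) : set 'rV[R]_n :=
  [set x | enorm x = 1].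

Definition unit_ball (R : realType) (n : nat) : set 'rV[R]_n :=
  [set x | enorm x <= 1].

(* Lebesgue integral over R^n, as an iterated one-dimensional Lebesgue
   integral.  It is only applied to bounded Borel functions vanishing outside
   the unit ball, for which Fubini's theorem applies. *)
Fixpoint lebesgue_int (R : realType) (n : nat) :
    ('rV[R]_n -> \bar R) -> \bar R :=
  match n return ('rV[R]_n -> \bar R) -> \bar R with
  | 0 => fun f => f 0
  | k.+1 => fun f =>
      (\int[@lebesgue_measure R]_t
         lebesgue_int (fun v : 'rV[R]_k => f (row_mx (t%:M : 'rV[R]_1) v)))%E
  end.

Definition ball_int (R : realType) (n : nat) (f : 'rV[R]_n -> R) : R :=
  fine (lebesgue_int (fun x => (\1_(@unit_ball R n) x * f x)%:E)).

(* The Lebesgue (surface) measure s of the sphere is the cone measure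
     s(A) = n * vol {t x | x in A, 0 < t <= 1},
   so the average of f with respect to s is the average over the unit ball of
   the radial extension x |-> f (x / |x|). *)
Definition sphere_avg (R : realType) (n : nat) (f : 'rV[R]_n -> R) : R :=
  ball_int (fun x => f ((enorm x)^-1 *: x)) / ball_int (fun _ : 'rV[R]_n => 1).

Definition finite_avg (R : realType) (n : nat) (C : {fset 'rV[R]_n})
    (f : 'rV[R]_n -> R) : R :=
  (\sum_(x <- C) f x) / #|` C|%:R.

Definition poly_eval (R : realType) (n : nat) (p : mpoly.mpoly n R)
    (x : 'rV[R]_n) : R :=
  mpoly.meval (fun i => x 0 i) p.

(* Total degree at most d.  [mpoly.msize] is not available without importing
   [mpoly], whose notations are incompatible with those of [all_analysis]. *)
Definition degree_le (R : realType) (n : nat) (p : mpoly.mpoly n R) (d : nat) :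
    bool :=
  all (fun m => (mpoly.mdeg m <= d)%N) (mpoly.msupp p).

Definition spherical_design (R : realType) (n tau : nat)
    (C : {fset 'rV[R]_n}) : Prop :=
  (forall x, x \in C -> @sphere R n x) /\
  (forall p : mpoly.mpoly n R, degree_le p tau ->
     finite_avg C (poly_eval p) = sphere_avg (poly_eval p)).

(* For a nonempty C the infimum and the supremum are attained. *)
Definition rho (R : realType) (n : nat) (C : {fset 'rV[R]_n}) : R :=
  inf [set sup [set dotp x y | x in [set` C]] | y in @sphere R n].

(* Here and below c stands for |C|. *)
Definition u (R : realType) (n c : nat) (a b : R) : R :=
  - (a / 2) + 1 / 2 *
    Num.sqrt (a ^+ 2 - 4 * b + 4 * Num.sqrt (c%:R / n%:R *
      (b ^+ 2 + (a ^+ 2 + 2 * b) / n%:R + 3 / (n%:R * (n%:R + 2))))).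

Definition b0 (R : realType) (n c : nat) : R :=
  (3 * n%:R * (n%:R + 1) - (n%:R + 2) * c%:R
   + Num.sqrt (n%:R * (n%:R - 1) *
       (2 * (n%:R + 2) * c%:R - 3 * n%:R * (n%:R + 3))))
  / (n%:R * (n%:R + 2) * (c%:R - 2 * n%:R)).

Definition a0 (R : realType) (n c : nat) : R :=
  (n%:R * b0 R n c + 1) / n%:R *
  Num.sqrt ((c%:R * (n%:R * b0 R n c + 1) - n%:R ^+ 2 * b0 R n c)
            / (n%:R * b0 R n c + 2)).

(* Main.v *)
Require Import Defs.
From mathcomp Require Import all_boot all_order all_algebra.
From mathcomp Require mpoly.

(* Let y minimize max_{x in C} <x, y> over the sphere, and let m be the minimum.
   At least n points of C are in contact with y, that is, satisfy <x, y> = m.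
   Hence, for q t = t^2 + a t + b,
     n * q(m)^2 <= sum_{x in C} q(<x, y>)^2,
   and the 4-design property evaluates the right-hand side as |C| times the
   spherical average of q^2.  Solving q(m) <= S for m gives m <= u(a, b) for
   all a and b, not only for a_0 and b_0.

   The moments of the sphere are computed on the design side.  The only fact
   needed about the integral is that lebesgue_int F(|x|^2, <y, x>) depends on y
   through |y| alone, for nonnegative measurable F; it follows by induction on
   the dimension from invariance of plane integrals under shears. *)

Set Implicit Arguments.
Unset Strict Implicit.
Unset Printing Implicit Defensive.

Import GRing.Theory.
Local Open Scope ring_scope.

(* The notations of mpoly clash with those of all_analysis; the module confines
   their import. *)
Module MPoly.
Import mpoly.

(** * Powers of affine forms as polynomials of bounded degree *)

Section aff.
Variables (R : comNzRingType) (n : nat).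
Implicit Types (p q : {mpoly R[n]}).

Lemma all_mdegM p q d e :
  all (fun m => mdeg m <= d)%N (msupp p) -> all (fun m => mdeg m <= e)%N (msupp q) ->
  all (fun m => mdeg m <= d + e)%N (msupp (p * q)).
Proof.
move=> /allP hp /allP hq; apply/allP => m /msuppM_le /allpairsP[[m1 m2] /= [m1p m2q ->]].
by rewrite mdegD leq_add ?hp ?hq.
Qed.

(** These powers are the only test polynomials to which the design property gets applied. *)
Lemma exists_affine_power (y : 'I_n -> R) (e : R) (k : nat) :
  exists p : mpoly n R, all (fun m => mdeg m <= k)%N (msupp p) /\
    forall v : 'I_n -> R, meval v p = (e + \sum_i y i * v i) ^+ k.
Proof.
pose l : {mpoly R[n]} := e%:MP + \sum_i y i *: 'X_i.
exists (l ^+ k); split.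
  elim: k => [|k IH]; first by rewrite expr0 msupp1 /= mdeg0.
  rewrite exprS -add1n; apply: all_mdegM => //.
  apply/allP => m /msuppD_le; rewrite mem_cat => /orP[|].
    by rewrite msuppC; case: ifP => // _; rewrite inE => /eqP->; rewrite mdeg0.
  move=> /msupp_sum_le /flattenP[s /mapP[i _ ->]] /msuppZ_le.
  by rewrite msuppX inE => /eqP ->; rewrite mdeg1.
move=> v; rewrite rmorphXn /= mevalD mevalC raddf_sum /=; congr ((_ + _) ^+ _).
by apply: eq_bigr => i _; rewrite mevalZ mevalXU.
Qed.
End aff.
End MPoly.

From mathcomp Require Import finmap.
From mathcomp Require Import all_classical all_reals all_analysis.
From mathcomp Require Import measurable_realfun.
From mathcomp Require Import ring lra.
Import Order.TTheory Num.Theory numFieldNormedType.Exports.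
Local Open Scope classical_set_scope.
Local Open Scope ring_scope.

(** * The Euclidean inner product on row vectors *)

Section dotp_theory.
Variables (R : realType) (n : nat).
Implicit Types x y z : 'rV[R]_n.

Lemma dotpC x y : dotp x y = dotp y x.
Proof. by apply: eq_bigr => i _; rewrite mulrC. Qed.

Lemma dotpDl x y z : dotp (x + y) z = dotp x z + dotp y z.
Proof. by rewrite /dotp -big_split; apply: eq_bigr => i _; rewrite mxE mulrDl. Qed.

Lemma dotpNl x y : dotp (- x) y = - dotp x y.
Proof. by rewrite /dotp -sumrN; apply: eq_bigr => i _; rewrite mxE mulNr. Qed.

Lemma dotpZl a x y : dotp (a *: x) y = a * dotp x y.
Proof. by rewrite /dotp mulr_sumr; apply: eq_bigr => i _; rewrite mxE mulrA. Qed.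

Lemma dotpZr a x y : dotp x (a *: y) = a * dotp x y.
Proof. by rewrite /dotp mulr_sumr; apply: eq_bigr => i _; rewrite mxE mulrCA. Qed.

Lemma dotp_row_mx (s t : R) x y :
  dotp (row_mx (s%:M : 'rV_1) x) (row_mx (t%:M : 'rV_1) y) = s * t + dotp x y.
Proof.
rewrite /dotp big_split_ord /= big_ord1 !row_mxEl !mxE !eqxx !mulr1n.
by congr (_ + _); apply: eq_bigr => i _; rewrite !row_mxEr.
Qed.

Lemma dotp_ge0 x : 0 <= dotp x x.
Proof. by apply: sumr_ge0 => i _; rewrite -expr2 sqr_ge0. Qed.

Lemma enorm_sqr y : enorm y ^+ 2 = dotp y y.
Proof. by rewrite sqr_sqrtr // dotp_ge0. Qed.

Lemma dotp_delta (i : 'I_n) x : dotp (delta_mx 0 i) x = x 0 i.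
Proof.
rewrite /dotp (bigD1 i) //= mxE !eqxx mul1r big1 ?addr0 // => j ji.
by rewrite mxE eqxx (negPf ji) mul0r.
Qed.

Lemma sphereP x : @sphere R n x <-> dotp x x = 1.
Proof.
rewrite /sphere /= -enorm_sqr; split => [->|/eqP]; first by rewrite expr1n.
by rewrite sqrf_eq1 => /orP[/eqP //|/eqP h]; have := sqrtr_ge0 (dotp x x); rewrite -/(enorm x) h ler0N1.
Qed.
End dotp_theory.

(** * Invariance of Lebesgue integrals on the line and in the plane *)

Section lebesgue_invariance.
Variable R : realType.
Implicit Types (f : R -> \bar R) (K : R * R -> \bar R).
Local Notation mu := (@lebesgue_measure R).

(** The pushforward of Lebesgue measure under a translation gives every interval its own length,
    hence is Lebesgue measure by uniqueness. *)
Lemma ge0_integral_lebesgue_shift (c : R) f : measurable_fun setT f ->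
  (forall t, 0 <= f t)%E ->
  (\int[mu]_t f (t + c)%R = \int[mu]_t f t)%E.
Proof.
move=> mf f0.
pose phi : measurableTypeR R -> measurableTypeR R := fun t => t + c.
have mphi : measurable_fun setT phi by exact: measurable_funD.
transitivity (\int[pushforward mu phi]_t f t)%E.
  by rewrite (ge0_integral_pushforward mphi).
apply: eq_measure_integral => A mA _; apply/esym.
apply: lebesgue_measure_unique => //= _ [[a b] /= _ <-].
rewrite /pushforward.
have -> : phi @^-1` [set` `]a, b]] = [set` `]a - c, b - c]].
  by apply/seteqP; split => t /=; rewrite !in_itv /= /phi ltrBlDr lerBrDr.
rewrite !lebesgue_measure_itv /= !lte_fin ltrD2r.
by case: ifP => // _; rewrite -EFinD; congr EFin; ring.
Qed.

Lemma ge0_integral_lebesgueN f : measurable_fun setT f ->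
  (forall t, 0 <= f t)%E ->
  (\int[mu]_t f (- t)%R = \int[mu]_t f t)%E.
Proof.
move=> mf f0.
pose phi : measurableTypeR R -> measurableTypeR R := -%R.
have mphi : measurable_fun setT phi by exact: oppr_measurable.
transitivity (\int[pushforward mu phi]_t f t)%E.
  by rewrite (ge0_integral_pushforward mphi).
by apply: eq_measure_integral => A mA _; exact: lebesgue_measureN.
Qed.

Lemma lebesgue_tonelli K : measurable_fun setT K -> (forall z, 0 <= K z)%E ->
  (\int[mu]_t \int[mu]_s K (t, s) = \int[mu]_s \int[mu]_t K (t, s))%E.
Proof.
exact: (@fubini_tonelli _ _ (measurableTypeR R) (measurableTypeR R) R mu mu).
Qed.

Lemma measurable_shear1 (q : R) K : measurable_fun setT K ->
  measurable_fun setT (fun z : R * R => K (z.1 + q * z.2, z.2)).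
Proof.
move=> mK; apply: (measurableT_comp mK); apply: measurable_fun_pair => //=.
by apply: measurable_funD => //; apply: measurable_funM.
Qed.

Lemma measurable_shear2 (q : R) K : measurable_fun setT K ->
  measurable_fun setT (fun z : R * R => K (z.1, z.2 + q * z.1)).
Proof.
move=> mK; apply: (measurableT_comp mK); apply: measurable_fun_pair => //=.
by apply: measurable_funD => //; apply: measurable_funM.
Qed.

(** For fixed [s] the shear is a translation in [t]; Tonelli moves the integral over [t] inside,
    where translation invariance applies. *)
Lemma integral2_shear1 (c : R) K : measurable_fun setT K ->
  (forall z, 0 <= K z)%E ->
  (\int[mu]_t \int[mu]_s K ((t + c * s)%R, s) =
   \int[mu]_t \int[mu]_s K (t, s))%E.
Proof.
move=> mK K0.
rewrite [LHS](lebesgue_tonelli (measurable_shear1 c mK) (fun z => K0 _)) /=.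
rewrite (lebesgue_tonelli mK K0); apply: eq_integral => s _.
apply: (@ge0_integral_lebesgue_shift (c * s) (fun t => K (t, s))) => //.
by apply: (measurableT_comp mK); exact: measurable_fun_pair.
Qed.

Lemma integral2_shear2 (c : R) K : measurable_fun setT K ->
  (forall z, 0 <= K z)%E ->
  (\int[mu]_t \int[mu]_s K (t, (s + c * t)%R) =
   \int[mu]_t \int[mu]_s K (t, s))%E.
Proof.
move=> mK K0; apply: eq_integral => t _.
apply: (@ge0_integral_lebesgue_shift (c * t) (fun s => K (t, s))) => //.
by apply: (measurableT_comp mK); exact: measurable_fun_pair.
Qed.

(* A plane rotation other than the half-turn is a product of three shears. *)
Lemma integral2_rotation (c s : R) K : c ^+ 2 + s ^+ 2 = 1 -> s != 0 ->
  measurable_fun setT K -> (forall z, 0 <= K z)%E ->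
  (\int[mu]_x \int[mu]_y K ((c * x + s * y)%R, (c * y - s * x)%R) =
   \int[mu]_x \int[mu]_y K (x, y))%E.
Proof.
move=> cs s0 mK K0.
(* For an angle with cosine [c] and sine [s], this is the tangent of the half-angle. The three
   shears have parameters [p], [- s] and [p]. *)
pose p := (1 - c) / s.
rewrite -(integral2_shear1 p mK K0).
rewrite -(integral2_shear2 (- s) (measurable_shear1 p mK) (fun z => K0 _)) /=.
rewrite -(integral2_shear1 p (measurable_shear2 (- s) (measurable_shear1 p mK)) (fun z => K0 _)) /=.
apply: eq_integral => x _; apply: eq_integral => y _.
have cE : c = 1 - p * s by rewrite /p mulfVK //; ring.
(* Substitute c = 1 - p s in c^2 + s^2 = 1 and cancel one factor [s]. *)
have sE : s = 2 * p - p ^+ 2 * s.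
  apply: (mulIf s0); have := cs; rewrite cE => h.
  by apply/eqP; rewrite -subr_eq0 -oppr_eq0; apply/eqP; move: h; lra.
congr (K (_, _)); rewrite cE; last by ring.
by rewrite {2}sE; ring.
Qed.

(** The rotation with cosine [p / r] and sine [q / r] preserves x^2 + y^2 and turns r x into p x + q
    y. When [q] vanishes, [integral2_rotation] does not apply; then [p] is [r] or [- r], and
    reflecting x settles the second case. *)
Lemma integral2_polar (p q r : R) K : p ^+ 2 + q ^+ 2 = r ^+ 2 -> 0 <= r ->
  measurable_fun setT K -> (forall z, 0 <= K z)%E ->
  (\int[mu]_x \int[mu]_y K ((x * x + y * y)%R, (p * x + q * y)%R) =
   \int[mu]_x \int[mu]_y K ((x * x + y * y)%R, (r * x)%R))%E.
Proof.
move=> pqr r0 mK K0.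
have mlin : measurable_fun setT (fun z : R * R => K (z.1 * z.1 + z.2 * z.2, r * z.1)).
  apply: (measurableT_comp mK); apply: measurable_fun_pair => /=.
    by apply: measurable_funD; apply: measurable_funM.
  by apply: measurable_funM.
have [q0|q0] := eqVneq q 0.
  have : (p == r) || (p == - r) by rewrite -eqf_sqr -pqr q0 expr0n addr0.
  case/orP => /eqP ->.
    by apply: eq_integral => x _; apply: eq_integral => y _; rewrite q0 mul0r addr0.
  have mF := @measurable_fun_fubini_tonelli_F _ _ (measurableTypeR R)
    (measurableTypeR R) R mu _ mlin (fun z => K0 _).
  rewrite -[RHS](ge0_integral_lebesgueN mF); last first.
    by move=> t; apply: integral_ge0.
  apply: eq_integral => x _; apply: eq_integral => y _.
  by rewrite q0 mul0r addr0 mulrNN mulrN mulNr.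
have rn0 : r != 0.
  apply: contra_neq q0 => r00; move: pqr; rewrite r00 expr0n /= => /eqP.
  by rewrite paddr_eq0 ?sqr_ge0 // !sqrf_eq0 => /andP[_ /eqP].
have cs : (p / r) ^+ 2 + (q / r) ^+ 2 = 1.
  by rewrite !expr_div_n -mulrDl pqr divff // expf_neq0.
have qr0 : q / r != 0 by rewrite mulf_neq0 ?invr_eq0.
rewrite -[RHS](integral2_rotation cs qr0 mlin (fun z => K0 _)) /=.
apply: eq_integral => x _; apply: eq_integral => y _; congr (K (_, _)).
  set c := p / r; set s := q / r.
  transitivity ((c ^+ 2 + s ^+ 2) * (x * x + y * y)); last by ring.
  by rewrite cs mul1r.
by field.
Qed.

End lebesgue_invariance.

(** * Iterated integrals of functions of |x|^2 and <y, x> *)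

Section radial.
Variable R : realType.
Implicit Types (F : R * R -> \bar R).
Local Notation mu := (@lebesgue_measure R).

Lemma lebesgue_int_ge0 n (f : 'rV[R]_n -> \bar R) :
  (forall x, 0 <= f x)%E -> (0 <= lebesgue_int f)%E.
Proof.
elim: n f => [|n IH] f f0 //=.
by apply: integral_ge0 => t _; apply: IH.
Qed.

(** The offset [z.1] absorbs the square of each coordinate split off, so that the induction closes;
    each step is the measurability of a partial integral. *)
Lemma measurable_radial n F : measurable_fun setT F -> (forall z, 0 <= F z)%E ->
  measurable_fun setT
    (fun z : R * R => lebesgue_int (fun x : 'rV[R]_n => F (z.1 + dotp x x, z.2))).
Proof.
move=> mF F0; elim: n => [|n IH] /=.
  apply: (measurableT_comp mF); apply: measurable_fun_pair => //=.
  by apply: measurable_funD.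
pose G (z : (R * R) * R) : \bar R :=
  lebesgue_int (fun x : 'rV[R]_n => F (z.1.1 + z.2 * z.2 + dotp x x, z.1.2)).
have mG : measurable_fun setT G.
  apply: (@measurableT_comp _ _ _ _ _ _ _ _ (fun w : (R * R) * R => (w.1.1 + w.2 * w.2, w.1.2)) IH).
  apply: measurable_fun_pair => /=; last first.
    by apply: (measurableT_comp measurable_snd).
  apply: measurable_funD; last by apply: measurable_funM.
  by apply: (measurableT_comp measurable_fst).
have := @measurable_fun_fubini_tonelli_F _ _ _
    (measurableTypeR R) R mu _ mG (fun z => lebesgue_int_ge0 (fun x => F0 _)).
rewrite /fubini_F /G; congr measurable_fun.
apply/funext => z /=; apply: eq_integral => t _; congr lebesgue_int.
by apply/funext => x; rewrite dotp_row_mx addrA.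
Qed.

Lemma lebesgue_intS n (f : 'rV[R]_n.+1 -> \bar R) : lebesgue_int f =
  (\int[mu]_t lebesgue_int (fun v : 'rV[R]_n => f (row_mx (t%:M : 'rV_1) v)))%E.
Proof. by []. Qed.

Lemma eq_lebesgue_int n (f g : 'rV[R]_n -> \bar R) :
  f =1 g -> lebesgue_int f = lebesgue_int g.
Proof. by move=> /funext ->. Qed.

(** The right-hand side involves [y] only through its norm. In the induction step y = (y0, y'): the
    hypothesis for y' leaves a plane integral with the form y0 t + |y'| s, which [integral2_polar]
    replaces by |y| t. *)
Lemma lebesgue_int_radial n F (y : 'rV[R]_n.+1) :
  measurable_fun setT F -> (forall z, 0 <= F z)%E ->
  lebesgue_int (fun x => F (dotp x x, dotp y x)) =
  (\int[mu]_t lebesgue_int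
     (fun v : 'rV[R]_n => F ((t * t + dotp v v)%R, (enorm y * t)%R)))%E.
Proof.
elim: n F y => [|n IH] F y mF F0.
  have [y0 [y' yE]] : exists y0 y', y = row_mx (y0%:M : 'rV_1) (y' : 'rV_0).
    exists (lsubmx (y : 'rV_(1 + 0)) 0 0), (rsubmx (y : 'rV_(1 + 0))).
    by rewrite -mx11_scalar hsubmxK.
  have dotp0 (v w : 'rV[R]_0) : dotp v w = 0 by rewrite /dotp big_ord0.
  have yn : enorm y = `|y0|.
    by rewrite /enorm yE dotp_row_mx dotp0 addr0 -expr2 sqrtr_sqr.
  rewrite yn /=.
  have mG : measurable_fun setT (fun t : R => F (t * t + dotp 0 (0 : 'rV[R]_0), `|y0| * t)).
    apply: (measurableT_comp mF); apply: measurable_fun_pair => /=.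
      by apply: measurable_funD => //; apply: measurable_funM.
    by apply: measurable_funM.
  (* In dimension one, |y0| differs from [y0] by a sign at most, which the reflection of the line
     removes. *)
  have [y00|y00] := leP 0 y0.
    by apply: eq_integral => t _; rewrite yE !dotp_row_mx !dotp0 !addr0 ger0_norm.
  rewrite -[RHS](ge0_integral_lebesgueN mG) //.
  apply: eq_integral => t _; rewrite yE !dotp_row_mx !dotp0 !addr0 ltr0_norm //.
  by rewrite !mulrNN.
have [y0 [y' yE]] : exists y0 y', y = row_mx (y0%:M : 'rV_1) (y' : 'rV_n.+1).
  exists (lsubmx (y : 'rV_(1 + n.+1)) 0 0), (rsubmx (y : 'rV_(1 + n.+1))).
  by rewrite -mx11_scalar hsubmxK.
pose H (z : R * R) := lebesgue_int (fun x : 'rV[R]_n => F (z.1 + dotp x x, z.2)).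
have mH : measurable_fun setT H by exact: measurable_radial.
have H0 z : (0 <= H z)%E by exact: lebesgue_int_ge0.
have nyE : y0 ^+ 2 + enorm y' ^+ 2 = enorm y ^+ 2.
  by rewrite !enorm_sqr yE dotp_row_mx expr2.
rewrite lebesgue_intS.
transitivity (\int[mu]_t \int[mu]_s H ((t * t + s * s)%R, (y0 * t + enorm y' * s)%R))%E.
  apply: eq_integral => t _.
  (* Fixing the first coordinate [t] shifts both arguments of [F]; this is why the induction
     hypothesis is kept general in [F]. *)
  pose G (z : R * R) := F (t * t + z.1, y0 * t + z.2).
  have mG : measurable_fun setT G.
    by apply: (measurableT_comp mF); apply: measurable_fun_pair => /=;
      apply: measurable_funD.
  transitivity (lebesgue_int (fun v : 'rV[R]_n.+1 => G (dotp v v, dotp y' v))).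
    by apply: eq_lebesgue_int => v; rewrite yE !dotp_row_mx.
  rewrite (IH G y' mG (fun z => F0 _)); apply: eq_integral => s _.
  by rewrite /H; apply: eq_lebesgue_int => v; rewrite /G /= addrA.
rewrite (integral2_polar nyE (sqrtr_ge0 _) mH H0).
apply: eq_integral => t _; rewrite lebesgue_intS; apply: eq_integral => s _.
by rewrite /H; apply: eq_lebesgue_int => v /=; rewrite dotp_row_mx addrA.
Qed.

End radial.

(** * Rotation invariance of the spherical average *)

Section sphere_avg_invariance.
Variable R : realType.

Lemma sphere_avg_enorm n (phi : R -> R) (y y' : 'rV[R]_n.+1) :
  measurable_fun setT phi -> (forall t, 0 <= phi t) -> enorm y = enorm y' ->
  sphere_avg (fun x => phi (dotp y x)) = sphere_avg (fun x => phi (dotp y' x)).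
Proof.
move=> mphi phi0 yy'; congr (_ / _).
(* Ball indicator and radial extension in terms of z = (|x|^2, <y, x>). The power -1/2 of |x|^2
   agrees with [(enorm x)^-1] even at x = 0, where both are 0. *)
pose F (z : R * R) : \bar R :=
  (\1_(`]-oo, 1] : set R) z.1 * phi (z.1 `^ (- 2^-1) * z.2))%:E.
have mF : measurable_fun setT F.
  apply/measurable_EFinP; apply: measurable_funM.
    by apply: (measurableT_comp _ measurable_fst); exact: measurable_indic.
  apply: (measurableT_comp mphi); apply: measurable_funM => //.
  exact: (measurableT_comp (measurable_powR _) measurable_fst).
have F0 z : (0 <= F z)%E by rewrite lee_fin mulr_ge0.
have ballE (w : 'rV[R]_n.+1) : ball_int (fun x => phi (dotp w ((enorm x)^-1 *: x)))
    = fine (lebesgue_int (fun x => F (dotp x x, dotp w x))).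
  congr fine; apply: eq_lebesgue_int => x; rewrite /F /=.
  rewrite dotpZr powRN powR12_sqrt ?dotp_ge0 //; congr ((_ * _)%:E).
  rewrite !indicE; congr ((nat_of_bool _)%:R).
  apply/idP/idP; rewrite !inE /= in_itv /= /unit_ball /= /enorm.
    by rewrite -{1}sqrtr1 ler_sqrt.
  by rewrite -{2}sqrtr1 ler_sqrt.
by rewrite !ballE !lebesgue_int_radial // yy'.
Qed.

End sphere_avg_invariance.

Lemma exists_affine_power_poly (R : realType) (n : nat) (y : 'rV[R]_n) (e : R) (k : nat) :
  exists p : mpoly.mpoly n R, degree_le p k /\
    poly_eval p = (fun x => (e + dotp y x) ^+ k).
Proof.
have [p [pk pE]] := MPoly.exists_affine_power (y 0) e k.
exists p; split => //.
by apply/funext => v; rewrite /poly_eval pE.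
Qed.

(** * Linearity of averages over a finite set *)

Section finite_avg_theory.
Variables (R : realType) (n : nat) (C : {fset 'rV[R]_n}).
Implicit Types f g : 'rV[R]_n -> R.

Lemma eq_finite_avg f g : {in C, f =1 g} -> finite_avg C f = finite_avg C g.
Proof. by move=> fg; congr (_ / _); apply: eq_big_seq. Qed.

Lemma finite_avgD f g :
  finite_avg C (fun x => f x + g x) = finite_avg C f + finite_avg C g.
Proof. by rewrite /finite_avg big_split mulrDl. Qed.

Lemma finite_avgZ a f : finite_avg C (fun x => a * f x) = a * finite_avg C f.
Proof. by rewrite /finite_avg -mulr_sumr mulrA. Qed.

Lemma finite_avg_sum (I : finType) (F : I -> 'rV[R]_n -> R) :
  finite_avg C (fun x => \sum_i F i x) = \sum_i finite_avg C (F i).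
Proof. by rewrite /finite_avg exchange_big mulr_suml. Qed.

Lemma finite_avg_cst a : C != fset0 -> finite_avg C (fun=> a) = a.
Proof.
move=> C0; rewrite /finite_avg big_const_seq count_predT -/(#|` C|) iter_addr_0.
by rewrite -[X in X / _]mulr_natr mulfK // pnatr_eq0 cardfs_eq0.
Qed.
End finite_avg_theory.

(** * Moments of a spherical 4-design up to order four *)

Section design.
Variables (R : realType) (n : nat) (C : {fset 'rV[R]_n.+1}).
Hypotheses (C4 : spherical_design 4 C) (C0 : C != fset0).
Local Notation A := (finite_avg C).

(** The design property passes to the spherical average, which sees only the norm; an even [k] makes
    the integrand nonnegative, as [sphere_avg_enorm] requires. *)
Lemma finite_avg_affine_power (e : R) (k : nat) (y y' : 'rV[R]_n.+1) : (k <= 4)%N -> ~~ odd k ->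
  enorm y = enorm y' ->
  finite_avg C (fun x => (e + dotp y x) ^+ k) =
  finite_avg C (fun x => (e + dotp y' x) ^+ k).
Proof.
move=> k4 ok yy'.
have avgE (w : 'rV[R]_n.+1) : finite_avg C (fun x => (e + dotp w x) ^+ k) =
    sphere_avg (fun x => (e + dotp w x) ^+ k).
  have [p [pk <-]] := exists_affine_power_poly w e k.
  apply: C4.2; apply: sub_all pk => m mk; exact: leq_trans mk k4.
rewrite !avgE; apply: (sphere_avg_enorm (phi := fun t => (e + t) ^+ k)) => //.
  by apply: measurable_funX; apply: measurable_funD.
by move=> t; rewrite exprn_even_ge0.
Qed.

(* The shifted even powers (1 + t)^2 and (1 + t)^4 give access to the odd moments
   while the integrands remain nonnegative. *)
Lemma design_odd_moments (y : 'rV[R]_n.+1) :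
  A (dotp y) = 0 /\ A (fun x => dotp y x ^+ 3) = 0.
Proof.
have ny : enorm y = enorm (- y).
  by rewrite /enorm dotpNl dotpC dotpNl opprK.
(* Compare [y] with [- y]: the difference of (1 + t)^k and (1 - t)^k is 4 t for k = 2, and 8 t + 8
   t^3 for k = 4. *)
have h2 : 4 * A (dotp y) = 0.
  have := finite_avg_affine_power 1 (isT : (2 <= 4)%N) isT ny.
  rewrite (eq_finite_avg (g := fun x => (1 + dotp (- y) x) ^+ 2 + 4 * dotp y x)).
    by rewrite finite_avgD finite_avgZ => h; move: h; lra.
  by move=> x _; rewrite dotpNl; ring.
have h4 : 8 * A (dotp y) + 8 * A (fun x => dotp y x ^+ 3) = 0.
  have := finite_avg_affine_power 1 (isT : (4 <= 4)%N) isT ny.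
  rewrite (eq_finite_avg (g := fun x => (1 + dotp (- y) x) ^+ 4
    + (8 * dotp y x + 8 * dotp y x ^+ 3))).
    by rewrite !finite_avgD !finite_avgZ => h; move: h; lra.
  by move=> x _; rewrite dotpNl; ring.
by split; lra.
Qed.

Lemma design_even_moment k (y y' : 'rV[R]_n.+1) : (k <= 4)%N -> ~~ odd k ->
  dotp y y = dotp y' y' ->
  A (fun x => dotp y x ^+ k) = A (fun x => dotp y' x ^+ k).
Proof.
move=> k4 ok yy'; have := finite_avg_affine_power 0 k4 ok (congr1 Num.sqrt yy').
by under eq_finite_avg do rewrite add0r; move=> ->; apply: eq_finite_avg => x _; rewrite add0r.
Qed.

Lemma sum_coord_sqr x : x \in C -> \sum_i x 0 i ^+ 2 = 1.
Proof.
by move=> /(C4.1)/sphereP <-; apply: eq_bigr => i _; rewrite expr2.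
Qed.

(** All coordinates have the same second moment as [y], and their squares sum to 1 on the sphere. *)
Lemma design_moment2 (y : 'rV[R]_n.+1) : dotp y y = 1 ->
  A (fun x => dotp y x ^+ 2) = n.+1%:R^-1.
Proof.
move=> y1; have n0 : n.+1%:R != 0 :> R by rewrite pnatr_eq0.
apply: (mulfI n0); rewrite divff // -[RHS](finite_avg_cst 1 C0).
rewrite -(eq_finite_avg sum_coord_sqr) finite_avg_sum.
transitivity (\sum_(i < n.+1) A (fun x => dotp y x ^+ 2)).
  by rewrite sumr_const card_ord mulr_natl.
apply: eq_bigr => i _.
rewrite (@design_even_moment 2 y (delta_mx 0 i)) ?dotp_delta ?mxE ?eqxx //.
by apply: eq_finite_avg => x _; rewrite dotp_delta.
Qed.

(** Polarization: (s + t)^4 + (s - t)^4 = 2 s^4 + 2 t^4 + 12 s^2 t^2. For distinct indices the sum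
    and the difference of the two basis vectors have squared norm 2, hence fourth moment 4 m, so the
    mixed moment is m / 3. *)
Lemma design_moment22 (y : 'rV[R]_n.+1) (i j : 'I_n.+1) : dotp y y = 1 ->
  A (fun x => x 0 i ^+ 2 * x 0 j ^+ 2) =
  (1 + 2 * (i == j)%:R) / 3 * A (fun x => dotp y x ^+ 4).
Proof.
move=> y1; set m := A (fun x => dotp y x ^+ 4).
have mE k : A (fun x => x 0 k ^+ 4) = m.
  rewrite /m (@design_even_moment 4 y (delta_mx 0 k)) ?dotp_delta ?mxE ?eqxx //.
  by apply: eq_finite_avg => x _; rewrite dotp_delta.
have [<-|ij] := eqVneq i j.
  rewrite -(mE i) mulr1 (_ : (1 + 2) / 3 = 1) ?mul1r; last by lra.
  by apply: eq_finite_avg => x _; ring.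
have s2 : 0 <= 2 :> R by [].
have mZ (z : 'rV[R]_n.+1) : dotp z z = 2 -> A (fun x => dotp z x ^+ 4) = 4 * m.
  move=> z2; rewrite (@design_even_moment 4 z (Num.sqrt 2 *: y)) //.
    rewrite -finite_avgZ; apply: eq_finite_avg => x _.
    by rewrite dotpZl exprMn (exprM _ 2 2) sqr_sqrtr //; ring.
  by rewrite dotpZl dotpC dotpZl y1 mulr1 -expr2 sqr_sqrtr.
have ji : j != i by rewrite eq_sym.
have hp := mZ (delta_mx 0 i + delta_mx 0 j).
have hm := mZ (delta_mx 0 i - delta_mx 0 j).
rewrite !dotpDl !dotpNl !dotp_delta !mxE !eqxx (negPf ij) (negPf ji) /= in hp hm.
have {}hp := hp ltac:(lra); have {}hm := hm ltac:(lra).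
have : A (fun x => dotp (delta_mx 0 i + delta_mx 0 j) x ^+ 4) +
       A (fun x => dotp (delta_mx 0 i - delta_mx 0 j) x ^+ 4) =
       2 * A (fun x => x 0 i ^+ 4) + (2 * A (fun x => x 0 j ^+ 4)
       + 12 * A (fun x => x 0 i ^+ 2 * x 0 j ^+ 2)).
  rewrite -!finite_avgZ -!finite_avgD; apply: eq_finite_avg => x _.
  by rewrite !dotpDl dotpNl !dotp_delta; ring.
by rewrite hp hm !mE mulr0 addr0 => h; lra.
Qed.

(** Average the square of sum_i x_i^2 = 1: with N the dimension, each of the N rows of mixed moments
    sums to (N + 2) m / 3. *)
Lemma design_moment4 (y : 'rV[R]_n.+1) : dotp y y = 1 ->
  A (fun x => dotp y x ^+ 4) = 3 / (n.+1%:R * (n.+1%:R + 2)).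
Proof.
move=> y1; set N : R := n.+1%:R; have N0 : 0 < N by rewrite ltr0n.
set m := A _.
have : \sum_(i < n.+1) \sum_(j < n.+1) A (fun x => x 0 i ^+ 2 * x 0 j ^+ 2) = 1.
  rewrite -(finite_avg_cst 1 C0); under eq_bigr do rewrite -finite_avg_sum.
  rewrite -finite_avg_sum; apply: eq_finite_avg => x xC.
  under eq_bigr do rewrite -mulr_sumr.
  by rewrite -mulr_suml sum_coord_sqr // mulr1.
rewrite (eq_bigr (fun=> (N + 2) / 3 * m)); last first.
  move=> i _; under eq_bigr do rewrite (design_moment22 _ _ y1) -/m.
  rewrite -!mulr_suml big_split /= sumr_const card_ord -mulr_sumr.
  rewrite (bigD1 i) //= eqxx big1 ?addr0 ?mulr1 // => j ji.
  by rewrite eq_sym (negPf ji).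
rewrite sumr_const card_ord -[X in X -> _]/(_ *+ _ = 1) -mulr_natl -/N => h.
have N2 : N + 2 != 0 by rewrite gt_eqF // addr_gt0.
apply: (mulfI (_ : N * (N + 2) != 0)); first by rewrite mulf_neq0 // gt_eqF.
rewrite [RHS]mulrC divfK ?mulf_neq0 ?gt_eqF ?addr_gt0 //; move: h; lra.
Qed.

(** The odd moments drop out of the expansion, leaving the bracket under the inner square root of
    [u]. *)
Lemma design_quadratic_sqr (y : 'rV[R]_n.+1) (a b : R) : dotp y y = 1 ->
  A (fun x => (dotp y x ^+ 2 + a * dotp y x + b) ^+ 2) =
  b ^+ 2 + (a ^+ 2 + 2 * b) / n.+1%:R + 3 / (n.+1%:R * (n.+1%:R + 2)).
Proof.
move=> y1; rewrite (eq_finite_avg (g := fun x => dotp y x ^+ 4 +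
  (2 * a * dotp y x ^+ 3 + ((a ^+ 2 + 2 * b) * dotp y x ^+ 2 +
  (2 * a * b * dotp y x + b ^+ 2))))); last by move=> x _; ring.
rewrite !finite_avgD !finite_avgZ finite_avg_cst //.
have [-> ->] := design_odd_moments y.
rewrite design_moment2 // design_moment4 //; ring.
Qed.

(** If all inner products were nonpositive, their zero mean would make them vanish, against the
    positive second moment. Positivity is used in [contact_points]. *)
Lemma design_max_gt0 (y : 'rV[R]_n.+1) m : dotp y y = 1 ->
  (forall x, x \in C -> dotp x y <= m) -> 0 < m.
Proof.
move=> y1 xm; rewrite ltNge; apply/negP => m0.
have t0 x : x \in C -> dotp y x = 0.
  move=> xC; apply/eqP; rewrite -oppr_eq0.
  have : \sum_(z <- C | z \in C) - dotp y z == 0.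
    rewrite -big_seq sumrN oppr_eq0.
    have /eqP := (design_odd_moments y).1; rewrite mulf_eq0 => /orP[//|].
    by rewrite invr_eq0 pnatr_eq0 cardfs_eq0 (negPf C0).
  rewrite psumr_eq0 => [/allP/(_ x xC)|z zC]; first by rewrite xC.
  by rewrite oppr_ge0 dotpC (le_trans (xm z zC)).
have /eqP := design_moment2 y1.
rewrite (eq_finite_avg (g := fun=> 0)) => [|x /t0 ->]; last by rewrite expr0n.
by rewrite finite_avg_cst // eq_sym invr_eq0 pnatr_eq0.
Qed.
End design.

(** * Compactness, maxima of linear forms, perturbation and orthogonality *)

Section geometry.
Variables (R : realType) (n : nat).
Implicit Types x y : 'rV[R]_n.

Lemma dotp_continuous x : continuous (dotp x : 'rV[R]_n -> R).
Proof.
rewrite /dotp; apply: (@continuous_big R _ +%R 0 xpredT) => [z|i _].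
  by apply: cvgD; [exact: cvg_fst|exact: cvg_snd].
move=> y; apply: (@continuous_comp _ _ _ (fun z : 'rV[R]_n => z 0 i) ( *%R (x 0 i))).
  exact: coord_continuous.
exact: mulrl_continuous.
Qed.

Lemma sphere_compact : compact (@sphere R n).
Proof.
have cdot : continuous (fun y : 'rV[R]_n => dotp y y : R).
  rewrite /dotp; apply: (@continuous_big R _ +%R 0 xpredT) => [z|i _].
    by apply: cvgD; [exact: cvg_fst|exact: cvg_snd].
  move=> y; apply: (@continuous_comp _ _ _ (fun z : 'rV[R]_n => z 0 i) (fun r => r * r)).
    exact: coord_continuous.
  by move=> r; apply: cvgM; exact: cvg_id.
have ccube : compact [set v : 'rV[R]_n | forall i, v ord0 i \in `[-1, 1]%R].
  by apply: (@rV_compact _ _ (fun=> `[(-1 : R), 1]%classic)) => _; exact: segment_compact.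
apply: (subclosed_compact _ ccube).
- have -> : @sphere R n = (fun y : 'rV[R]_n => dotp y y : R) @^-1` [set 1].
    by apply/seteqP; split => y /sphereP.
  apply: preimage_closed => [y _|]; [exact: cdot|exact: closed_eq].
- move=> y /sphereP y1 i /=; rewrite in_itv /= -ler_norml -(@expr_le1 _ 2) //.
  rewrite -y1 /dotp (bigD1 i) //= expr2 -normrM ger0_norm -?expr2 ?sqr_ge0 // lerDl.
  by apply: sumr_ge0 => j _; rewrite -expr2 sqr_ge0.
Qed.

(** Building the maximum along the list gives continuity, needed for the extreme value theorem,
    together with attainment. *)
Lemma exists_max_dotp (s : seq 'rV[R]_n) : s != [::] ->
  exists f : 'rV[R]_n -> R, continuous f /\ forall y,
    (exists2 x, x \in s & f y = dotp x y) /\ forall x, x \in s -> dotp x y <= f y.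
Proof.
elim: s => // a [|b s] IH _.
  exists (dotp a); split; first exact: dotp_continuous.
  move=> y; split; first by exists a; rewrite ?mem_head.
  by move=> x; rewrite inE => /eqP ->.
have [f [cf fP]] := IH isT.
exists (fun y => Num.max (dotp a y) (f y)); split.
  by move=> y; apply: continuous_max; [exact: dotp_continuous|exact: cf].
move=> y; have [[x xs fx] fle] := fP y; split.
  case: (leP (dotp a y) (f y)) => h; last by exists a; rewrite ?mem_head.
  by exists x => //; rewrite inE xs orbT.
move=> z; rewrite inE => /orP[/eqP ->|/fle zf]; first by rewrite le_max lexx.
by rewrite le_max zf orbT.
Qed.

Lemma small_perturbation (I : eqType) (s : seq I) (a b : I -> R) (m : R) :
  (forall i, i \in s -> a i < m) ->
  exists2 e, 0 < e & forall i, i \in s -> a i + e * b i <= m.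
Proof.
move=> am.
(* Strengthened to all smaller [d], so that the induction may shrink the bound [e]. *)
suff [e e0 he] : exists2 e, 0 < e & forall d, 0 <= d <= e ->
    forall i, i \in s -> a i + d * b i <= m.
  by exists e => //; apply: he; rewrite (ltW e0) lexx.
elim: s am => [|i s IH] am; first by exists 1.
have [|e e0 he] := IH; first by move=> j js; apply: am; rewrite inE js orbT.
have am0 : 0 < m - a i by rewrite subr_gt0 am // mem_head.
have b1 : 0 < `|b i| + 1 by rewrite ltr_wpDl.
(* The added 1 keeps the denominator positive when [b i] is 0. *)
exists (Num.min e ((m - a i) / (`|b i| + 1))).
  by rewrite lt_min e0 divr_gt0.
move=> d /andP[d0]; rewrite le_min => /andP[de dab] j.
rewrite inE => /orP[/eqP ->|]; last by apply: he; rewrite d0.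
rewrite -lerBrDl; apply: (le_trans (ler_norm _)); rewrite normrM (ger0_norm d0).
rewrite ler_pdivlMr // in dab; apply: le_trans dab.
by rewrite ler_wpM2l // lerDl.
Qed.

(** The matrix with rows [s] has rank at most [size s], less than [n], so some nonzero vector is
    orthogonal to all its rows. *)
Lemma exists_orthogonal (s : seq 'rV[R]_n) : (size s < n)%N ->
  exists2 v : 'rV[R]_n, v != 0 & forall x, x \in s -> dotp x v = 0.
Proof.
move=> sn; pose B : 'M[R]_(size s, n) := \matrix_(i < size s) nth 0 s i.
have kn0 : kermx B^T != 0.
  rewrite -mxrank_eq0 mxrank_ker -lt0n subn_gt0.
  by apply: leq_ltn_trans sn; exact: rank_leq_col.
exists (nz_row (kermx B^T)); first by rewrite nz_row_eq0.
move=> x /(nthP 0)[i si <-].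
have /sub_kermxP/matrixP/(_ 0 (Ordinal si)) := nz_row_sub (kermx B^T).
rewrite !mxE => <-; rewrite dotpC; apply: eq_bigr => j _.
by rewrite !mxE.
Qed.

End geometry.

(** * The covering quantity, contact points and the bound [u] *)

Section covering.
Variables (R : realType) (n : nat).
Implicit Types x y : 'rV[R]_n.

Lemma rho_le_max (C : {fset 'rV[R]_n}) y0 (f : 'rV[R]_n -> R) :
  (forall y, (exists2 x, x \in C & f y = dotp x y) /\
    forall x, x \in C -> dotp x y <= f y) ->
  @sphere R n y0 -> (forall y, @sphere R n y -> f y0 <= f y) ->
  rho C <= f y0.
Proof.
move=> fP Sy0 y0min.
have supE y : sup [set dotp x y | x in [set` C]] = f y.
  have [[x xC fx] fle] := fP y; apply/le_anti/andP; split.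
    apply: ge_sup; first by exists (dotp x y), x.
    by move=> _ [z zC <-]; exact: fle.
  rewrite fx; apply: ub_le_sup; last by exists x.
  by exists (f y) => _ [z zC <-]; exact: fle.
apply: ge_inf; last by exists y0.
(* A lower bound must be exhibited for [inf] to be a genuine infimum. *)
by exists (f y0) => _ [y Sy <-]; rewrite supE; exact: y0min.
Qed.

(* If fewer than n points were in contact, moving y0 in a direction orthogonal
   to them, which increases its norm, would decrease the maximum after
   normalization. *)
Lemma contact_points (s : seq 'rV[R]_n) y0 (f : 'rV[R]_n -> R) :
  (forall y, (exists2 x, x \in s & f y = dotp x y) /\
    forall x, x \in s -> dotp x y <= f y) ->
  @sphere R n y0 -> (forall y, @sphere R n y -> f y0 <= f y) -> 0 < f y0 ->
  (n <= count (fun x => dotp x y0 == f y0) s)%N.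
Proof.
move=> fP /sphereP y0y0 y0min f0; rewrite -size_filter leqNgt; apply/negP => few.
have [w w0 orth] := exists_orthogonal few.
have [v [v0 {}orth y0v]] : exists v, [/\ v != 0,
    forall x, x \in s -> dotp x y0 = f y0 -> dotp x v = 0 & 0 <= dotp y0 v].
  have orthw x : x \in s -> dotp x y0 = f y0 -> dotp x w = 0.
    by move=> xs xy0; apply: orth; rewrite mem_filter xs xy0 eqxx.
  (* The sign of [w] is chosen so that moving along [v] cannot shorten [y0]. *)
  have [wp|wn] := leP 0 (dotp y0 w); first by exists w.
  exists (- w); split; first by rewrite oppr_eq0.
    by move=> x xs xy0; rewrite dotpC dotpNl dotpC orthw // oppr0.
  by rewrite dotpC dotpNl dotpC oppr_ge0 ltW.
have apart x : x \in [seq x <- s | dotp x y0 != f y0] -> dotp x y0 < f y0.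
  rewrite mem_filter => /andP[xy0 xs].
  by rewrite lt_neqAle xy0; exact: (fP y0).2.
have [e e0 he] := small_perturbation (fun x => dotp x v) apart.
have le_f x : x \in s -> dotp x (y0 + e *: v) <= f y0.
  move=> xs; rewrite dotpC dotpDl dotpZl ![dotp _ x]dotpC.
  have [xy0|xy0] := eqVneq (dotp x y0) (f y0); first by rewrite xy0 orth // mulr0 addr0.
  by apply: he; rewrite mem_filter xy0.
have vv : 0 < dotp v v.
  rewrite lt_neqAle dotp_ge0 andbT eq_sym; apply: contra v0 => vv0.
  apply/eqP/rowP => i; rewrite mxE; apply/eqP; rewrite -sqrf_eq0.
  move: vv0; rewrite psumr_eq0 => [/allP/(_ i)|j _]; last by rewrite -expr2 sqr_ge0.
  by rewrite mem_index_enum expr2 => /(_ isT).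
set z := y0 + e *: v.
have zz : 1 < dotp z z.
  have -> : dotp z z = 1 + (2 * e * dotp y0 v + e ^+ 2 * dotp v v).
    rewrite /z dotpDl dotpZl ![dotp _ (_ + _)]dotpC !dotpDl !dotpZl y0y0.
    by rewrite (dotpC v y0); ring.
  by rewrite ltrDl ltr_wpDl ?mulr_gt0 ?exprn_gt0 // !mulr_ge0 // ltW.
have nz : 1 < enorm z by rewrite -sqrtr1 ltr_sqrt // (lt_trans ltr01).
have nz0 : 0 < enorm z := lt_trans ltr01 nz.
have Sz : @sphere R n ((enorm z)^-1 *: z).
  apply/sphereP; rewrite dotpZl dotpZr -enorm_sqr; field.
  by rewrite gt_eqF.
(* At z / |z| the maximum is <x, z> / |z|, at most f(y0) / |z|. Minimality then gives f(y0) |z| <=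
   f(y0), impossible as |z| > 1 and f(y0) > 0. *)
have := y0min _ Sz; have [[x xs ->] _] := fP ((enorm z)^-1 *: z).
rewrite dotpZr mulrC ler_pdivlMr // => h.
have : f y0 * enorm z <= f y0 by exact: le_trans h (le_f x xs).
by rewrite ger_pMr // leNgt nz.
Qed.

(** Completing the square, (2 m + a)^2 = a^2 - 4 b + 4 q. Both roots are extracted through x <= |x|,
    which covers either sign of q and of 2 m + a. *)
Lemma quadratic_le_u (c : nat) (a b m : R) : (0 < n)%N ->
  n%:R * (m ^+ 2 + a * m + b) ^+ 2 <=
    c%:R * (b ^+ 2 + (a ^+ 2 + 2 * b) / n%:R + 3 / (n%:R * (n%:R + 2))) ->
  m <= u n c a b.
Proof.
rewrite -(ltr0n R) /u => n0; set q := m ^+ 2 + a * m + b; set F := b ^+ 2 + _ + _ => h.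
have qS : q <= Num.sqrt (c%:R / n%:R * F).
  apply: (le_trans (ler_norm _)); rewrite -sqrtr_sqr ler_wsqrtr //.
  by rewrite mulrAC ler_pdivlMr // mulrC.
set S := Num.sqrt (_ * F) in qS *.
have : 2 * m + a <= Num.sqrt (a ^+ 2 - 4 * b + 4 * S).
  apply: (le_trans (ler_norm _)); rewrite -sqrtr_sqr ler_wsqrtr //.
  by rewrite /q in qS; nra.
lra.
Qed.

Lemma b0_card0_le0 : (0 < n)%N -> b0 R n 0 <= 0.
Proof.
rewrite -(ltr0n R) /b0 => n0; apply: mulr_ge0_le0.
  rewrite mulr0 subr0 addr_ge0 ?sqrtr_ge0 // !mulr_ge0 ?addr_ge0 // ltW //.
rewrite invr_le0 sub0r mulrN oppr_le0 !mulr_ge0 ?addr_ge0 // ltW //.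
Qed.

(** For c = 0 the inner root vanishes, and a^2 - 4 b >= a^2 makes the outer root at least |a|. *)
Lemma u_card0_ge0 (a b : R) : b <= 0 -> 0 <= u n 0 a b.
Proof.
move=> b_le0; rewrite /u !mul0r sqrtr0 mulr0 addr0.
have : `|a| <= Num.sqrt (a ^+ 2 - 4 * b) by rewrite -sqrtr_sqr ler_wsqrtr //; lra.
by have := ler_norm a; lra.
Qed.

Lemma rho_fset0 : rho (fset0 : {fset 'rV[R]_n}) = 0.
Proof.
rewrite /rho.
have s0 : [set` (fset0 : {fset 'rV[R]_n})] = set0 by apply/seteqP; split.
(* The supremum and infimum of the empty set have the default value 0, so both cases give 0. *)
rewrite s0; have [/eqP ->|/set0P[y Sy]] := boolP (@sphere R n == set0).
  by rewrite image_set0 inf0.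
rewrite (_ : [set _ | _ in _] = [set 0]) ?inf1 //.
apply/seteqP; split => [_ [z _ <-]|_ ->] /=; first by rewrite image_set0 sup0.
by exists y => //; rewrite image_set0 sup0.
Qed.

End covering.

Theorem theorem5p4 (R : realType) (n : nat) (C : {fset 'rV[R]_n}) :
  (2 <= n)%N ->
  spherical_design 4 C ->
  rho C <= u n #|` C| (a0 R n #|` C|) (b0 R n #|` C|).
Proof.
case: n C => // n C _ C4.
have [->|C0] := eqVneq C fset0.
  (* [b0] is nonpositive for |C| = 0, which spares proving that the ball has
     nonzero volume. *)
  by rewrite rho_fset0 cardfs0 u_card0_ge0 // b0_card0_le0.
have [f [cf fP]] : exists f : 'rV[R]_n.+1 -> R, continuous f /\ forall y,
    (exists2 x, x \in C & f y = dotp x y) /\ forall x, x \in C -> dotp x y <= f y.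
  apply: (@exists_max_dotp _ _ (enum_fset C)); apply: contra_neq C0 => C0.
  by apply/fsetP => x; rewrite in_fset0 -[x \in C]/(x \in enum_fset C) C0.
have S0 : @sphere R n.+1 !=set0.
  by exists (delta_mx 0 0); apply/sphereP; rewrite dotp_delta mxE eqxx.
have [y0 /set_mem Sy0 min] := EVT_min_rV S0 (@sphere_compact R n.+1)
  (continuous_subspaceT cf).
have {}min y : @sphere R n.+1 y -> f y0 <= f y by move=> Sy; apply: min; exact: mem_set.
have y0y0 : dotp y0 y0 = 1 by exact/sphereP.
have f0 : 0 < f y0 by exact: (design_max_gt0 C4 C0 y0y0 (fP y0).2).
apply: le_trans (rho_le_max fP Sy0 min) _.
(* With m = [f y0], what remains is the bound on the dimension times q(m)^2, whose right-hand side
   is |C| times a design average. *)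
apply: quadratic_le_u => //.
rewrite -(design_quadratic_sqr C4 C0 _ _ y0y0).
set a := a0 _ _ _; set b := b0 _ _ _.
pose q x : R := (dotp y0 x ^+ 2 + a * dotp y0 x + b) ^+ 2.
rewrite [leRHS](_ : _ = \sum_(x <- C) q x); last first.
  by rewrite mulrC divfK // pnatr_eq0 cardfs_eq0.
have contact := @contact_points _ _ (enum_fset C) _ _ fP Sy0 min f0.
(* Here [q] is the squared quadratic. Each contact point contributes its value at m, and discarding
   the other nonnegative terms only lowers the sum. *)
apply: (@le_trans _ _ (\sum_(x <- C | dotp x y0 == f y0) q x)).
  rewrite (eq_bigr (fun=> (f y0 ^+ 2 + a * f y0 + b) ^+ 2)); last first.
    by move=> x /eqP xy0; rewrite /q dotpC xy0.
  rewrite big_const_seq iter_addr_0 -[leRHS]mulr_natl ler_wpM2r ?sqr_ge0 //.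
  by rewrite ler_nat.
rewrite big_mkcond; apply: ler_sum => x _.
by case: ifP => // _; rewrite sqr_ge0.
Qed.
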